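(* If a composition (a sequence of positive integers) $\alpha=(\alpha_1,\alpha_2,\ldots,\alpha_s)$ satisfies $$\alpha_1\ge \alpha_2+\alpha_3+\cdots+\alpha_s,$$ then the rank generating function $r(q;\alpha)$ is unimodal with $$\operatorname{mi}(r(q;\alpha))=[\alpha_2+\alpha_3+\cdots+\alpha_s,\ \alpha_1],$$ where the right-hand side is an interval of integers.
   Context: For a composition $\alpha=(\alpha_1,\ldots,\alpha_s)$ of $n-1$ (positive integers with sum $n-1$), the fence poset $F(\alpha)$ has elements $x_1,\ldots,x_n$. For $1\le i\le s$ its $i$th segment is the set $\{x_j : \alpha_1+\cdots+\alpha_{i-1}+1\le j\le \alpha_1+\cdots+\alpha_i+1\}$. The covering relations are: consecutive elements of the $i$th segment satisfy $x_j\lhd x_{j+1}$ if $i$ is odd and $x_j\rhd x_{j+1}$ if $i$ is even. $L(\alpha)$ is the lattice of all lower order ideals of $F(\alpha)$, ranked by cardinality; $r_k(\alpha)$ is the number of order ideals of $F(\alpha)$ of cardinality $k$, and $r(q;\alpha)=\sum_{k\ge0} r_k(\alpha)q^k$. A polynomial with nonnegative coefficients is unimodal if its coefficient sequence $a_0,\ldots,a_n$ satisfies $a_0\le\cdots\le a_m\ge\cdots\ge a_n$ for some $m$. For $f=\sum_k a_kq^k$, the set of maxima indices is $\operatorname{mi}(f)=\{k : a_k=M\}$, where $M$ is the maximum value of a coefficient of $f$.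
   Formalization: The formula for mi is stated only for s ≥ 2: for s = 1 the fence is a chain with α₁+1 elements, so every index in [0, α₁+1] is a maximum and the printed interval [0, α₁] is wrong; unimodality is still proved for every s ≥ 1. *)

(* Defs.v *)
From HB Require Import structures.
From mathcomp Require Import all_boot all_order all_algebra zify.

Set Implicit Arguments.
Unset Strict Implicit.
Unset Printing Implicit Defensive.

Import Order.TTheory GRing.Theory.

Definition composition (alpha : seq nat) : bool := all (fun a => 0 < a) alpha.

(* Indices start at 0: the [i]th segment here is the (i+1)th usual one, and
   [j] stands for x_(j+1); the usual odd (ascending) segments have [i] even. *)
Definition psum (alpha : seq nat) (i : nat) : nat := sumn (take i alpha).

Definition in_segment (alpha : seq nat) (i j : nat) : bool :=
  psum alpha i <= j <= psum alpha i.+1.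

Definition fence (alpha : seq nat) : Type := 'I_(sumn alpha).+1.
HB.instance Definition _ (alpha : seq nat) := Finite.on (fence alpha).

Definition fence_cover (alpha : seq nat) : rel (fence alpha) :=
  fun x y => [exists i : 'I_(size alpha),
    [&& in_segment alpha i x, in_segment alpha i y
      & if odd i then x == y.+1 :> nat else y == x.+1 :> nat]].

Definition fence_le (alpha : seq nat) : rel (fence alpha) :=
  connect (@fence_cover alpha).

Section FenceOrder.
Variable alpha : seq nat.

(* Antisymmetry of [fence_le]: [height] strictly increases along covers. *)
Let up (j : nat) : bool := [exists i : 'I_(size alpha),
  ~~ odd i && (psum alpha i <= j < psum alpha i.+1)].

Let height (j : nat) : int := \sum_(k < j) (if up k then 1 else -1)%R.

Lemma leq_psum i j : i <= j -> psum alpha i <= psum alpha j.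
Proof.
move=> le_ij; rewrite /psum -(subnKC le_ij) takeD sumn_cat.
exact: leq_addr.
Qed.

Let height_cover (x y : fence alpha) :
  fence_cover x y -> height y = (height x + 1)%R.
Proof.
case/existsP=> i /and3P[/andP[ix xi] /andP[iy yi]].
have heightS j : height j.+1 = (height j + if up j then 1 else -1)%R.
  by rewrite /height big_ord_recr.
case: ifPn => oi /eqP Exy; rewrite Exy heightS.
- suff /negbTE-> : ~~ up y by lia.
  apply/existsP=> -[k /and3P[ok ky yk]].
  have [lt_ik|lt_ki|eq_ik] := ltngtP i k.
  + by have := leq_psum lt_ik; lia.
  + by have := leq_psum lt_ki; lia.
  + by rewrite -eq_ik oi in ok.
- have -> // : up x by apply/existsP; exists i; rewrite oi ix -Exy.
Qed.

Let le_height (x y : fence alpha) : fence_le x y ->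
  (x == y) || (height x < height y)%R.
Proof.
case/connectP=> p + ->; elim: p x => [|z p IHp] x /=; first by rewrite eqxx.
case/andP=> /height_cover Ez /IHp; case: eqP => [<-|_ /=]; first by lia.
by case: eqP => //= _; lia.
Qed.

Lemma fence_le_refl : reflexive (@fence_le alpha).
Proof. exact: connect0. Qed.

Lemma fence_le_trans : transitive (@fence_le alpha).
Proof. exact: connect_trans. Qed.

Lemma fence_le_anti : antisymmetric (@fence_le alpha).
Proof.
move=> x y /andP[/le_height/orP[/eqP//|lt_xy] /le_height/orP[/eqP//|lt_yx]].
by have := lt_trans lt_xy lt_yx; rewrite ltxx.
Qed.

Lemma fence_cover_between (x y z : fence alpha) : fence_cover x y ->
  fence_le x z -> fence_le z y -> (z == x) || (z == y).
Proof.
move=> /height_cover Ey /le_height/orP[/eqP->|xz]; first by rewrite eqxx.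
by case/le_height/orP=> [->|zy]; [rewrite orbT | lia].
Qed.

Lemma fence_cover_neq (x y : fence alpha) : fence_cover x y -> x != y.
Proof. by move=> /height_cover Ey; apply: contra_eq_neq Ey => ->; lia. Qed.

End FenceOrder.

Fact fence_display : Order.disp_t. Proof. exact: Order.Disp tt tt. Qed.

HB.instance Definition _ (alpha : seq nat) :=
  Order.Le_isPOrder.Build fence_display (fence alpha)
    (@fence_le_refl alpha) (@fence_le_anti alpha) (@fence_le_trans alpha).

Lemma fence_coverP (alpha : seq nat) (x y : fence alpha) :
  reflect ((x < y)%O /\ forall z : fence alpha, ~~ (x < z < y)%O)
          (fence_cover x y).
Proof.
have cover_lt u v : fence_cover u v -> (u < v :> fence alpha)%O.
  by move=> cov; rewrite lt_neqAle fence_cover_neq //=; apply: connect1.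
apply: (iffP idP) => [cov | [lt_xy nbetw]].
  split=> [|z]; first exact: cover_lt.
  apply/negP=> /andP[xz zy].
  case/orP: (fence_cover_between cov (ltW xz) (ltW zy)) => /eqP Ez.
    by rewrite Ez ltxx in xz.
  by rewrite Ez ltxx in zy.
have /connectP[[|z p] /= path_p Ey] : fence_le x y by apply: ltW lt_xy.
  by rewrite Ey ltxx in lt_xy.
case/andP: path_p => cov_xz path_p.
have le_zy : (z <= y)%O by apply/connectP; exists p.
have := nbetw z; rewrite cover_lt //= lt_neqAle le_zy andbT negbK.
by move=> /eqP <-.
Qed.

Definition order_ideal d (T : finPOrderType d) (I : {set T}) : bool :=
  [forall x, forall y, ((x <= y)%O && (y \in I)) ==> (x \in I)].

Definition rank_number (alpha : seq nat) (k : nat) : nat :=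
  #|[set I : {set fence alpha} | order_ideal I & #|I| == k]|.

(* No ideal has more than #|{: fence alpha}| elements. *)
Definition rank_gf (alpha : seq nat) : {poly nat} :=
  \poly_(k < #|{: fence alpha}|.+1) rank_number alpha k.

(* Coefficients beyond the degree are 0, hence cannot break the descent. *)
Definition unimodal (f : {poly nat}) : Prop :=
  exists m : nat,
    (forall k, k < m -> (f`_k)%R <= (f`_k.+1)%R) /\
    (forall k, m <= k -> (f`_k.+1)%R <= (f`_k)%R).

Definition max_coef (f : {poly nat}) : nat := \max_(k < size f) (f`_k)%R.

Definition mi (f : {poly nat}) : pred nat :=
  [pred k | (k < size f) && ((f`_k)%R == max_coef f)].

(* Main.v *)
(* Put a = alpha_1 and b = alpha_2 + ... + alpha_s. An ideal meets the first
   segment, a chain of a + 1 elements, in its i lowest elements for some i, so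
   an ideal of cardinality k is determined by its part J above that segment. If
   i <= a any ideal J is allowed, whereas i = a + 1 forces x_(a+2) into J when
   b > 0. Decreasing i is always possible when i > 0, which is automatic for
   ideals with more than b elements; increasing i is possible when i < a, which
   is automatic for ideals with fewer than a elements. Hence the set of possible
   J grows with k up to k = a and shrinks from k = b on, so it is constant on
   [b, a]. It grows strictly before b because of the J with i = 0, and shrinks
   strictly from a to a + 1, when b > 0, because the empty J is lost. *)
Require Import Defs.
From HB Require Import structures.
From mathcomp Require Import all_boot all_order all_algebra.
From mathcomp Require Import zify.

Set Implicit Arguments.
Unset Strict Implicit.
Unset Printing Implicit Defensive.

Import Order.TTheory.

(** * Sequences with a plateau of maxima *)

Lemma homo_leq_above (u : nat -> nat) (b : nat) :
  (forall k, b <= k -> u k.+1 <= u k) ->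
  forall m n, b <= m -> m <= n -> u n <= u m.
Proof.
move=> dec m n bm /subnKC <-; elim: (n - m) => [|d IHd]; first by rewrite addn0.
by rewrite addnS; apply: leq_trans IHd; apply: dec; lia.
Qed.

Lemma homo_ltn_below (u : nat -> nat) (a : nat) :
  (forall k, k < a -> u k < u k.+1) ->
  forall m n, m < n -> n <= a -> u m < u n.
Proof.
move=> inc m; elim=> // n IHn; rewrite ltnS leq_eqVlt => /orP[/eqP->|mn] na.
  exact: inc.
by apply: ltn_trans (inc _ na); apply: IHn => //; apply: ltnW.
Qed.

Lemma mi_plateau (f : {poly nat}) (a b : nat) : a <= b ->
    (forall k, k < a -> (f`_k)%R < (f`_k.+1)%R) ->
    (forall k, a <= k < b -> (f`_k.+1)%R = (f`_k)%R) ->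
    (f`_b.+1)%R < (f`_b)%R ->
    (forall k, b <= k -> (f`_k.+1)%R <= (f`_k)%R) ->
  forall k, (k \in mi f) = (a <= k <= b).
Proof.
move=> le_ab inc cst drop dec.
have const k : a <= k <= b -> (f`_k)%R = (f`_a)%R.
  move=> /andP[/subnKC <-]; elim: (k - a) => [|d IHd]; first by rewrite addn0.
  by rewrite addnS => le_b; rewrite cst ?IHd //; lia.
have lt_fa k : ~~ (a <= k <= b) -> (f`_k)%R < (f`_a)%R.
  rewrite negb_and -!ltnNge => /orP[ka|bk].
    exact: (homo_ltn_below inc).
  rewrite -(const b) ?le_ab ?leqnn //; apply: leq_ltn_trans drop.
  by apply: (homo_leq_above dec) => //; apply: leqnSn.
have le_fa k : (f`_k)%R <= (f`_a)%R.
  by case: (boolP (a <= k <= b)) => [/const->|/lt_fa/ltnW].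
(* [mi] only admits indices below [size f]; a positive plateau value puts the whole plateau
   there. *)
have fa_gt0 : 0 < (f`_a)%R.
  by rewrite -(const b) ?le_ab ?leqnn //; apply: leq_ltn_trans drop.
have supp k : 0 < (f`_k)%R -> k < size f.
  by move=> fk; rewrite ltnNge; apply: contraL fk => /(nth_default _)->.
have maxE : max_coef f = (f`_a)%R.
  apply/eqP; rewrite eqn_leq; apply/andP; split; first exact/bigmax_leqP.
  exact: (leq_bigmax (Ordinal (supp a fa_gt0))).
move=> k; rewrite inE maxE; case: (boolP (a <= k <= b)) => [/const fk|/lt_fa].
  by rewrite fk eqxx andbT supp ?fk.
by rewrite ltn_neqAle => /andP[/negbTE-> _]; rewrite andbF.
Qed.

(** * Order ideals of finite posets and of fences *)

Lemma order_idealP d (T : finPOrderType d) (I : {set T}) :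
  reflect (forall x y, (x <= y)%O -> y \in I -> x \in I) (order_ideal I).
Proof.
apply: (iffP forallP) => [idI x y xy yI | idI x].
  by have /forallP/(_ y) := idI x; rewrite xy yI.
by apply/forallP=> y; apply/implyP=> /andP[]; apply: idI.
Qed.

Lemma order_ideal_pred d (T : finPOrderType d) (I : {set T}) :
  order_ideal I -> I != set0 ->
  exists2 I' : {set T}, order_ideal I' & (I' \subset I) && (#|I| == #|I'|.+1).
Proof.
move=> /order_idealP idI /set0Pn[x0 x0I].
(* An element of [I] with the largest principal ideal is maximal in [I], so it can be removed. *)
pose h x := #|[set y : T | (y <= x)%O]|.
case: (@arg_maxnP _ x0 [in I] h x0I) => z /= zI zmax.
exists (I :\ z); last by rewrite subD1set (cardsD1 z I) zI eqxx.
apply/order_idealP=> x y xy /setD1P[yz yI].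
rewrite !inE (idI _ _ xy yI) andbT; apply: contra_neqN yz => /eqP xz.
apply/eqP; apply: contraT => yz; rewrite {x}xz in xy.
have := zmax y yI; rewrite leqNgt => /negP[]; apply: proper_card.
apply/properP; split.
  by apply/subsetP=> t; rewrite !inE => /le_trans->.
exists y; rewrite !inE ?lexx //; apply: contra yz => yz.
by rewrite eq_le yz.
Qed.

Lemma order_ideal_subcard d (T : finPOrderType d) (I : {set T}) m :
  order_ideal I -> m <= #|I| ->
  exists2 I' : {set T}, order_ideal I' & (I' \subset I) && (#|I'| == m).
Proof.
move=> + /subnK; move: (_ - _) => d'.
elim: d' I => [|d' IHd] I idI card_I.
  by exists I; rewrite ?subxx ?andTb -?card_I.
have /order_ideal_pred : I != set0 by rewrite -card_gt0 -card_I.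
case/(_ idI)=> I1 idI1 /andP[sI1 /eqP cI1].
have [|I2 idI2 /andP[sI2 cI2]] := IHd I1 idI1; first by lia.
by exists I2; rewrite // (subset_trans sI2 sI1).
Qed.

Lemma fence_idealP (alpha : seq nat) (I : {set fence alpha}) :
  reflect (forall x y, fence_cover x y -> y \in I -> x \in I) (order_ideal I).
Proof.
apply: (iffP (order_idealP I)) => idI x y.
  by move=> /connect1; apply: idI.
case/connectP=> p + ->; elim: p x => [|z p IHp] x //= /andP[xz /IHp zI] yI.
exact: idI xz (zI yI).
Qed.

(* Simplification makes the hidden bounds of ordinals syntactically equal. *)
Ltac simpl_lia := simpl in *; lia.

(** * Splitting ideals of the fence along its first segment *)

Section FirstSegment.
Variables (a : nat) (s : seq nat).
Hypothesis alpha_comp : composition (a :: s).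
Local Notation alpha := (a :: s).
Local Notation b := (sumn s).

Lemma psum1_leq i : a <= psum alpha i.+1.
Proof. by rewrite /psum /= leq_addr. Qed.

(** Positivity of the second part keeps the third and later segments strictly beyond the peak
    [a]. *)
Lemma psum2_ltn i : i < size s -> a < psum alpha i.+2.
Proof.
by case: s alpha_comp => //= c t /and3P[_ c0 _] _; rewrite /psum /=; simpl_lia.
Qed.

Lemma fence_cover_first (x y : fence alpha) : x <= a ->
  fence_cover x y = (x < a) && (y == x.+1 :> nat).
Proof.
(* The second segment descends from [a], so the lower element of any of its covers lies beyond [a];
   later segments start beyond [a]. *)
move=> /= xa; apply/existsP/andP => [[[[|[|i]] /= lti]]|[lxa /eqP yx]].
- rewrite /in_segment /psum /= take0 /= => /and3P[_ ya yx].
  by split=> //; move: ya; rewrite (eqP yx); simpl_lia.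
- rewrite /in_segment /= => /and3P[/andP[le1 _] /andP[le2 _] /eqP exy].
  by have := psum1_leq 0; simpl_lia.
- rewrite /in_segment /= => /and3P[/andP[le1 _] _ _].
  by have := @psum2_ltn i; simpl_lia.
- by exists ord0; rewrite /in_segment /psum /= take0 /= yx eqxx; simpl_lia.
Qed.

Lemma fence_cover_enter (x y : fence alpha) : a < x -> y <= a ->
  fence_cover x y -> y = a :> nat /\ x = a.+1 :> nat.
Proof.
move=> /= ax ya /existsP[[[|i] /= lti]].
  by rewrite /in_segment /psum /= take0 /=; simpl_lia.
rewrite /in_segment /= => /and3P[/andP[le1 _] /andP[le2 _] exy].
by have := psum1_leq i; move: exy; case: ifP => _ /eqP; simpl_lia.
Qed.

Lemma fence_cover_peak (x y : fence alpha) :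
  x = a.+1 :> nat -> y = a :> nat -> fence_cover x y.
Proof.
move=> xa ya; have : a.+1 < (a + b).+1 by rewrite -xa; apply: (ltn_ord x).
rewrite ltnS => ltab; apply/existsP.
have lts : 1 < size alpha by case: s ltab => //=; rewrite addn0 ltnn.
exists (Ordinal lts); rewrite /= /in_segment xa ya eqxx.
have -> : psum alpha 1 = a by rewrite /psum /= take0 /= addn0.
have := @psum2_ltn 0 lts.
by simpl_lia.
Qed.

(** The whole first segment is [seg a.+1]; [seg a] omits the peak. *)
Definition seg (i : nat) : {set fence alpha} := [set x : fence alpha | x < i].

Lemma card_seg i : i <= (a + b).+1 -> #|seg i| = i.
Proof.
move=> lei; pose w (j : 'I_i) : fence alpha := widen_ord lei j.
have w_inj : injective w by move=> u v /(congr1 val) /= /val_inj.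
rewrite -[RHS]card_ord -(card_imset _ w_inj).
apply: eq_card => x; rewrite inE; apply/idP/imsetP => [xi | [j _ ->]] //=.
by exists (Ordinal xi) => //; apply: val_inj.
Qed.

Lemma fence_le_first (x y : fence alpha) : x <= y -> y <= a -> (x <= y)%O.
Proof.
move=> /subnKC; move: (y - x) => d; elim: d y => [|d IHd] y dE ya.
  by rewrite (_ : x = y) //; apply: val_inj; rewrite /= -dE addn0.
have lty := ltn_ord y.
have ltz : x + d < (a + b).+1 by simpl_lia.
pose z : fence alpha := Ordinal ltz.
apply: (@le_trans _ _ z); first by apply: IHd => //=; simpl_lia.
by apply: connect1; rewrite fence_cover_first /=; simpl_lia.
Qed.

Lemma ideal_first_segment (I : {set fence alpha}) i : order_ideal I ->
  i <= a.+1 -> exists2 i', i' <= i & I :&: seg i = seg i'.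
Proof.
move=> /order_idealP idI; elim: i => [|i IHi] lei.
  by exists 0 => //; apply/setP=> x; rewrite !inE andbF.
have [|i' lei' segI] := IHi; first exact: ltnW.
have lti : i < (a + b).+1 by simpl_lia.
pose z : fence alpha := Ordinal lti.
case: (boolP (z \in I)) => [zI|zI]; last first.
  exists i'; rewrite ?(leq_trans lei') //; apply/setP=> x.
  rewrite -segI !inE [x < i.+1]ltnS leq_eqVlt andb_orr.
  case: eqP => [xi|_]; last by rewrite andbF.
  by have -> : x = z; [apply: val_inj | rewrite (negbTE zI)].
exists i.+1 => //; apply/setP=> x; rewrite !inE andbC.
case: (ltnP x i.+1) => //= xi.
by apply: idI zI; apply: fence_le_first.
Qed.

(* The part of an ideal above the first segment determines the ideal once its
   cardinality [k] is known, so that rank numbers can be compared through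
   inclusions between the sets [tails k]. *)
Definition tails (k : nat) : {set {set fence alpha}} :=
  [set I :\: seg a.+1 | I in [set I | order_ideal I & #|I| == k]].

Lemma card_segU i (J : {set fence alpha}) : i <= a.+1 ->
  [disjoint seg a.+1 & J] -> #|seg i :|: J| = i + #|J|.
Proof.
move=> lei disJ; rewrite cardsU card_seg; last by simpl_lia.
rewrite (_ : _ :&: _ = set0) ?cards0 ?subn0 //.
apply/eqP; rewrite setI_eq0; apply: disjointWl disJ.
by apply/subsetP=> x; rewrite !inE => /leq_trans->.
Qed.

(** With [J] fixed, passing between [k] and [k.+1] only shifts [i] by one. *)
Lemma tailsP k (J : {set fence alpha}) : reflect
  (exists2 i, i <= a.+1 & [/\ [disjoint seg a.+1 & J], i + #|J| = k
                            & order_ideal (seg i :|: J)])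
  (J \in tails k).
Proof.
apply: (iffP imsetP) => [[I] | [i lei [disJ cJ idJ]]].
  rewrite inE => /andP[idI /eqP cI] ->{J}.
  have [i lei segI] := ideal_first_segment idI (leqnn _).
  have dis : [disjoint seg a.+1 & I :\: seg a.+1].
    by rewrite -setI_eq0 setDE setICA setICr setI0.
  have IE : seg i :|: (I :\: seg a.+1) = I by rewrite -segI setID.
  by exists i => //; rewrite -card_segU // IE.
exists (seg i :|: J); first by rewrite inE idJ card_segU // cJ eqxx.
rewrite setDUl (_ : seg i :\: _ = set0) ?set0U.
  by apply/esym/setDidPl; rewrite disjoint_sym.
by apply/eqP; rewrite setD_eq0; apply/subsetP=> x; rewrite !inE => /leq_trans->.
Qed.

Lemma card_tails k : #|tails k| = rank_number alpha k.
Proof.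
apply: card_in_imset => I1 I2; rewrite !inE.
move=> /andP[id1 /eqP c1] /andP[id2 /eqP c2] eqD.
have [i1 le1 seg1] := ideal_first_segment id1 (leqnn _).
have [i2 le2 seg2] := ideal_first_segment id2 (leqnn _).
have := cardsID (seg a.+1) I1; have := cardsID (seg a.+1) I2.
rewrite c1 c2 seg1 seg2 eqD !card_seg; [|simpl_lia..].
move=> <- /addIn eqi.
by rewrite -(setID I1 (seg a.+1)) -(setID I2 (seg a.+1)) seg1 seg2 eqD eqi.
Qed.

(** A cover whose lower element is in the first segment stays in it, so no element of [J] covers one
    of [seg i]. *)
Lemma ideal_tail i (J : {set fence alpha}) : [disjoint seg a.+1 & J] ->
  order_ideal (seg i :|: J) -> i <= a.+1 -> order_ideal J.
Proof.
move=> disJ /order_idealP idJ lei.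
have notseg x : x \in J -> a < x.
  by move=> xJ; have := disjointFl disJ xJ; rewrite inE ltnNge => /negbFE.
apply/fence_idealP => x y xy yJ.
have := idJ x y (connect1 xy); rewrite !inE yJ orbT => /(_ isT) /orP[xi|//].
move: xy; rewrite fence_cover_first; last by simpl_lia.
by have := notseg y yJ; simpl_lia.
Qed.

(** Only the peak [a] covers something outside the first segment, and [i <= a] leaves it out, so
    [seg i] demands nothing of [J]. *)
Lemma ideal_segU i (J : {set fence alpha}) : order_ideal J -> i <= a ->
  order_ideal (seg i :|: J).
Proof.
move=> /order_idealP idJ lei; apply/fence_idealP=> x y xy.
rewrite !inE => /orP[yi|yJ]; last first.
  by rewrite (idJ x y) ?orbT //; apply: connect1.
case: (leqP x a) => xa; last first.
  by have [|ya _] := fence_cover_enter xa _ xy; simpl_lia.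
by move: xy; rewrite fence_cover_first; simpl_lia.
Qed.

Lemma card_tail (J : {set fence alpha}) : [disjoint seg a.+1 & J] -> #|J| <= b.
Proof.
move=> disJ; have := max_card (mem (seg a.+1 :|: J)).
by rewrite card_segU // card_ord /=; simpl_lia.
Qed.

Lemma tails_down k : b <= k -> tails k.+1 \subset tails k.
Proof.
move=> lebk; apply/subsetP=> J /tailsP[i lei [disJ cJ idJ]].
apply/tailsP; have cJb := card_tail disJ.
(* Here [i > 0], because [#|J| <= b <= k] while [i + #|J| = k.+1]. *)
exists i.-1; first by simpl_lia.
split=> //; first by lia.
by apply: ideal_segU; [apply: ideal_tail idJ _ | lia].
Qed.

Lemma tails_up k : k < a -> tails k \subset tails k.+1.
Proof.
move=> ltka; apply/subsetP=> J /tailsP[i lei [disJ cJ idJ]].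
(* Since [i <= k < a], the peak is still left out after adding one element. *)
apply/tailsP; exists i.+1; first by simpl_lia.
split=> //; first by lia.
by apply: ideal_segU; [apply: ideal_tail idJ _ | lia].
Qed.

Lemma tails_up_proper k : b <= a -> k < b -> tails k \proper tails k.+1.
Proof.
move=> leba ltkb; apply/properP; split; first by apply: tails_up; simpl_lia.
have disC : [disjoint seg a.+1 & ~: seg a.+1].
  by rewrite -setI_eq0 setICr.
have idC : order_ideal (~: seg a.+1).
  apply/fence_idealP=> x y xy; rewrite !inE -!leqNgt => ya.
  case: (leqP x a) => // xa.
  by move: xy; rewrite fence_cover_first; simpl_lia.
have cC : #|~: seg a.+1| = b.
  by have := cardsC (seg a.+1); rewrite card_ord card_seg /=; simpl_lia.
(* An ideal of size [k.+1] avoiding the first segment is a tail for [k.+1] with [i = 0], but is too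
   large to be one for [k]. *)
have [|J idJ /andP[sJ /eqP cJ]] := @order_ideal_subcard _ _ _ k.+1 idC.
  by rewrite cC.
have disJ := disjointWr sJ disC.
exists J; last by apply/tailsP=> -[i _ [_]]; rewrite cJ; lia.
by apply/tailsP; exists 0 => //; split=> //; apply: ideal_segU.
Qed.

Lemma tails_down_proper : 0 < b <= a -> tails a.+1 \proper tails a.
Proof.
move=> /andP[b_gt0 leba]; apply/properP; split; first exact: tails_down.
have dis0 : [disjoint seg a.+1 & set0] by rewrite -setI_eq0 setI0.
exists set0.
  apply/tailsP; exists a => //; split; rewrite ?cards0 ?addn0 //.
  by apply: ideal_segU => //; apply/order_idealP=> x y; rewrite !inE.
(* An empty tail at [a.+1] needs [i = a.+1]: the peak would be present without [a.+1], which lies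
   below it. *)
apply/tailsP=> -[i lei [_]]; rewrite cards0 addn0 => ->.
have lt1 : a.+1 < (a + b).+1 by simpl_lia.
have lt0 : a < (a + b).+1 by simpl_lia.
move=> /fence_idealP/(_ (Ordinal lt1) (Ordinal lt0)).
by rewrite fence_cover_peak // !inE /= ltnSn ltnn => /(_ isT isT).
Qed.

Lemma coef_rank_gf k : ((rank_gf alpha)`_k)%R = #|tails k|.
Proof.
rewrite card_tails coef_poly; case: ltnP => // ltk; apply/esym/eqP.
rewrite cards_eq0 -subset0; apply/subsetP=> I; rewrite !inE => /andP[_ /eqP cI].
by have := max_card (mem I); rewrite cI leqNgt ltk.
Qed.

End FirstSegment.

Theorem theorem2p3 (alpha1 : nat) (alphas : seq nat)
    (halpha : composition (alpha1 :: alphas))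
    (hge : sumn alphas <= alpha1) :
  unimodal (rank_gf (alpha1 :: alphas)) /\
  (alphas <> [::] ->
   forall k : nat,
     (k \in mi (rank_gf (alpha1 :: alphas))) = (sumn alphas <= k <= alpha1)).
Proof.
pose f := rank_gf (alpha1 :: alphas).
have coefE k : (f`_k)%R = #|tails alpha1 alphas k| by apply: coef_rank_gf.
have inc k : k < sumn alphas -> (f`_k)%R < (f`_k.+1)%R.
  by move=> ltk; rewrite !coefE; apply: proper_card; apply: tails_up_proper.
have dec k : sumn alphas <= k -> (f`_k.+1)%R <= (f`_k)%R.
  by move=> lek; rewrite !coefE; apply: subset_leq_card; apply: tails_down.
split; first by exists (sumn alphas); split=> // k /inc/ltnW.
move=> alphas_neq0; apply: mi_plateau => //.
- move=> k /andP[lek ltk]; apply/eqP; rewrite eqn_leq; apply/andP.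
  split; first exact: dec.
  by rewrite !coefE; apply: subset_leq_card; apply: tails_up.
(* The drop after [alpha1] needs a second segment: a single one gives a chain, whose rank numbers
   stay 1 up to [alpha1.+1]. *)
- rewrite !coefE; apply: proper_card; apply: tails_down_proper; rewrite // hge.
  case: alphas halpha alphas_neq0 {hge coefE inc dec} @f => //= c t.
  by case/and3P=> _ c_gt0 _ _; rewrite addn_gt0 c_gt0.
- by move=> k lek; apply: dec; lia.
Qed.
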